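(* Let $n\ge1$. There exists an action of the braid group $\mathcal{B}_n$ on $n$ strands on the set $\mathrm{PF}_n$ of parking functions on $n$ elements such that, for each of the elementary braids $\alpha_1,\ldots,\alpha_{n-1}$, every orbit of the action of $\alpha_k$ (i.e. of the cyclic group it generates) on $\mathrm{PF}_n$ has length $2$ or length $3$.
   Context: A parking function on $n$ elements is a function $f:\{1,\ldots,n\}\to\{1,\ldots,n\}$ with $|f^{-1}(\{1,\ldots,k\})|\ge k$ for all $k\in\{1,\ldots,n\}$. The braid group $\mathcal{B}_n$ is generated by the elementary braids $\alpha_1,\ldots,\alpha_{n-1}$ with relations $\alpha_k\alpha_m=\alpha_m\alpha_k$ for $|k-m|>1$ and $\alpha_k\alpha_{k+1}\alpha_k=\alpha_{k+1}\alpha_k\alpha_{k+1}$. *)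

(* Defs.v *)
From HB Require Import structures.
From mathcomp Require Import all_boot boolp.

Set Implicit Arguments.
Unset Strict Implicit.
Unset Printing Implicit Defensive.

Local Open Scope group_scope.
Local Open Scope quotient_scope.

(* The ordinal i : 'I_n stands for the element i + 1 of {1, ..., n}, so the   *)
(* set of j : 'I_n with j < k is {1, ..., k}; the case k = 0 is vacuous.      *)
Definition is_parking n (f : {ffun 'I_n -> 'I_n}) : bool :=
  [forall k : 'I_n.+1, k <= #|f @^-1: [set j : 'I_n | j < k]|].

Definition parking n := {f : {ffun 'I_n -> 'I_n} | is_parking f}.

(* The letter (k, false) is the generator alpha_(k+1), and (k, true) is its   *)
(* formal inverse.                                                            *)
Definition braid_word n := seq ('I_n.-1 * bool).

(* Two words are related when they have the same image in every group in     *)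
(* which the braid relations hold: the least congruence for concatenation     *)
(* containing free cancellation and the defining relations.                   *)
Inductive braid_eq n : braid_word n -> braid_word n -> Prop :=
| braid_eq_refl w : braid_eq w w
| braid_eq_sym w w' : braid_eq w w' -> braid_eq w' w
| braid_eq_trans w w' w'' : braid_eq w w' -> braid_eq w' w'' -> braid_eq w w''
| braid_eq_cat u u' v v' :
    braid_eq u u' -> braid_eq v v' -> braid_eq (u ++ v) (u' ++ v')
| braid_eq_cancel k b : braid_eq [:: (k, b); (k, ~~ b)] [::]
| braid_eq_far (k m : 'I_n.-1) : (k.+1 < m) || (m.+1 < k) ->
    braid_eq [:: (k, false); (m, false)] [:: (m, false); (k, false)]
| braid_eq_near (k m : 'I_n.-1) : m = k.+1 :> nat ->
    braid_eq [:: (k, false); (m, false); (k, false)]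
             [:: (m, false); (k, false); (m, false)].

Section BraidGroup.
Variable n : nat.
Implicit Types u v w : braid_word n.

Definition braid_eqb : rel (braid_word n) := fun u v => `[< braid_eq u v >].

Lemma braid_eqb_refl : reflexive braid_eqb.
Proof. by move=> u; apply/asboolP/braid_eq_refl. Qed.

Lemma braid_eqb_sym : symmetric braid_eqb.
Proof. by move=> u v; apply/asboolP/asboolP => /braid_eq_sym. Qed.

Lemma braid_eqb_trans : transitive braid_eqb.
Proof.
move=> v u w /asboolP uv /asboolP vw.
by apply/asboolP; exact: braid_eq_trans uv vw.
Qed.

Canonical braid_equiv :=
  EquivRel braid_eqb braid_eqb_refl braid_eqb_sym braid_eqb_trans.

Definition braid := {eq_quot braid_equiv}.

HB.instance Definition _ := Choice.on braid.
HB.instance Definition _ := EqQuotient.on braid.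

Definition braid_of_word w : braid := \pi_braid w.

Lemma braid_of_wordP u v : braid_of_word u = braid_of_word v <-> braid_eq u v.
Proof.
split=> [/eqmodP/asboolP //|uv].
by apply/eqmodP/asboolP.
Qed.

Definition word_inv w : braid_word n := rev [seq (a.1, ~~ a.2) | a <- w].

Lemma word_inv_cat u v : word_inv (u ++ v) = word_inv v ++ word_inv u.
Proof. by rewrite /word_inv map_cat rev_cat. Qed.

Lemma word_invK : involutive word_inv.
Proof.
move=> w; rewrite /word_inv map_rev revK -map_comp -[RHS]map_id.
by apply: eq_map => -[k b] /=; rewrite negbK.
Qed.

Lemma braid_eq_catV w : braid_eq (w ++ word_inv w) [::].
Proof.
elim: w => [|[k b] w IHw]; first exact: braid_eq_refl.
rewrite -cat1s word_inv_cat -catA (catA w).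
apply: braid_eq_trans (braid_eq_cancel k b).
rewrite -[[:: (k, b); (k, ~~ b)]]/([:: (k, b)] ++ ([::] ++ [:: (k, ~~ b)])).
apply: braid_eq_cat; first exact: braid_eq_refl.
by apply: braid_eq_cat => //; exact: braid_eq_refl.
Qed.

Lemma braid_eq_Vcat w : braid_eq (word_inv w ++ w) [::].
Proof. by rewrite -{2}[w]word_invK; apply: braid_eq_catV. Qed.

Lemma braid_eq_inv u v : braid_eq u v -> braid_eq (word_inv u) (word_inv v).
Proof.
move=> uv; rewrite -[word_inv u]cats0.
apply: braid_eq_trans (_ : braid_eq _ (word_inv u ++ (v ++ word_inv v))) _.
  apply: braid_eq_cat; first exact: braid_eq_refl.
  exact/braid_eq_sym/braid_eq_catV.
rewrite catA -[X in braid_eq _ X]cat0s.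
apply: braid_eq_cat; last exact: braid_eq_refl.
apply: braid_eq_trans (braid_eq_Vcat u).
by apply: braid_eq_cat; [exact: braid_eq_refl | exact: braid_eq_sym].
Qed.

Definition braid_one : braid := braid_of_word [::].
Definition braid_mul (g h : braid) : braid := braid_of_word (repr g ++ repr h).
Definition braid_inv (g : braid) : braid := braid_of_word (word_inv (repr g)).

Lemma braid_reprK w : braid_eq (repr (braid_of_word w)) w.
Proof. by apply/braid_of_wordP; rewrite /braid_of_word reprK. Qed.

Lemma braid_mulE u v :
  braid_mul (braid_of_word u) (braid_of_word v) = braid_of_word (u ++ v).
Proof. by apply/braid_of_wordP/braid_eq_cat; exact: braid_reprK. Qed.

Lemma braid_invE u : braid_inv (braid_of_word u) = braid_of_word (word_inv u).
Proof. by apply/braid_of_wordP/braid_eq_inv/braid_reprK. Qed.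

Lemma braid_ind_word (P : braid -> Prop) :
  (forall w, P (braid_of_word w)) -> forall g, P g.
Proof. by move=> Pw g; rewrite -[g]reprK; exact: Pw. Qed.

Lemma braid_mulA : associative braid_mul.
Proof.
elim/braid_ind_word=> u; elim/braid_ind_word=> v; elim/braid_ind_word=> w.
by rewrite !braid_mulE catA.
Qed.

Lemma braid_mul1 : left_id braid_one braid_mul.
Proof. by elim/braid_ind_word=> u; rewrite braid_mulE. Qed.

Lemma braid_mulr1 : right_id braid_one braid_mul.
Proof. by elim/braid_ind_word=> u; rewrite braid_mulE cats0. Qed.

Lemma braid_mulV : left_inverse braid_one braid_inv braid_mul.
Proof.
elim/braid_ind_word=> u; rewrite braid_invE braid_mulE.
exact/braid_of_wordP/braid_eq_Vcat.
Qed.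

Lemma braid_mulrV : right_inverse braid_one braid_inv braid_mul.
Proof.
elim/braid_ind_word=> u; rewrite braid_invE braid_mulE.
exact/braid_of_wordP/braid_eq_catV.
Qed.

HB.instance Definition _ := isGroup.Build braid
  braid_mulA braid_mul1 braid_mulr1 braid_mulV braid_mulrV.

Definition alpha (k : 'I_n.-1) : braid := braid_of_word [:: (k, false)].

End BraidGroup.

(* The actions of the action.v library are those of finite groups only.       *)
Record left_action (G : groupType) (T : Type) := LeftAction {
  act :> G -> T -> T;
  act1 : forall x, act 1 x = x;
  actM : forall g h x, act (g * h) x = act g (act h x)
}.

Definition in_cyclic (G : groupType) (g h : G) : Prop :=
  exists m : nat, h = g ^+ m \/ h = g ^- m.

Definition cyclic_orbit (G : groupType) (T : finType) (a : left_action G T)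
    (g : G) (x : T) : {set T} :=
  [set y | `[< exists2 h, in_cyclic g h & y = a h x >]].

(* Main.v *)
Require Import Defs.
From mathcomp Require Import all_boot perm zify boolp.

(** The braid group acts on the n-tuples of elements of any group by Hurwitz
    moves: the k-th generator replaces the adjacent entries x, y by x y x^-1,
    x. A move keeps the product of the tuple and only conjugates entries, so
    the action restricts to the factorizations t_1 ... t_n of the (n+1)-cycle
    c = (0 1 ... n) into n transpositions, where permutations are multiplied
    from left to right. There the orbits of a generator are short: two
    commuting transpositions are merely exchanged, and two transpositions x, y
    with x y x = y x y come back after three moves. No move fixes a
    factorization, since a fixed one would contain t, t in adjacent places,
    and cancelling them would write c with n - 2 transpositions although an
    (n+1)-cycle needs n of them ([factorization_not_fixed]).

    It remains to identify these factorizations with parking functions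
    ([parking_factorizations]). Write t_i = (a_i b_i) with a_i < b_i; then i
    |-> a_i is a parking function with values in {0, ..., n-1}, it determines
    the factorization, and every parking function arises. To prove this by
    induction, consider more generally a permutation w each of whose cycles is
    an increasing cycle on a block of an equivalence relation E
    ([cyclic_succ]). If (a b) is the first factor of a minimal factorization
    of w, then (a b) w is again of this kind: the elements of ]a, b] split off
    from the block of a and b ([cut], [cut_succ]). On the side of labels, a
    word is called parking for E if, for each x in a block B, at least as many
    labels in B are at most x as there are elements of B at most x, except
    that at the maximum x of B there is exactly one label less
    ([block_parking]). By a ballot argument ([block_parking_cut]), the word f
    is parking after the cut at (a, b) exactly when a :: f is parking before
    it and b is the first place above a where the number of labels in ]a, b]
    falls behind the number of elements. Such a b exists and is unique
    ([cut_exists], [cut_unique]), so the letters a_i determine the b_i one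
    after the other. That the first factor of a minimal factorization always
    is a cut comes from counting cycles: a transposition that joins two cycles
    would leave too few factors for the rest ([minimal_cons]). *)

Set Implicit Arguments.
Unset Strict Implicit.
Unset Printing Implicit Defensive.

Local Open Scope group_scope.

(** * Actions of the braid group and orbits of one element *)

Section BraidAction.
Variables (n : nat) (T : Type) (s s' : 'I_n.-1 -> T -> T).
Hypothesis sK : forall k, cancel (s k) (s' k).
Hypothesis s'K : forall k, cancel (s' k) (s k).
Hypothesis s_far : forall (k m : 'I_n.-1) x, k.+1 < m ->
  s k (s m x) = s m (s k x).
Hypothesis s_near : forall (k m : 'I_n.-1) x, m = k.+1 :> nat ->
  s k (s m (s k x)) = s m (s k (s m x)).

Definition word_act (w : braid_word n) (x : T) : T :=
  foldr (fun a => if a.2 then s' a.1 else s a.1) x w.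

Lemma word_act_cat u v x : word_act (u ++ v) x = word_act u (word_act v x).
Proof. exact: foldr_cat. Qed.

(** The relations assumed of the generators are those that generate the
    congruence on words, so that the action of a word depends only on its
    braid. *)
Lemma word_act_braid_eq u v x : braid_eq u v -> word_act u x = word_act v x.
Proof.
move=> uv; elim: uv x => {u v}
  [//|u v _ IH|u v w _ IHu _ IHv|u u' v v' _ IHu _ IHv|k []|k m h|k m h] x //=.
- by rewrite IHu.
- by rewrite !word_act_cat IHv IHu.
- exact: sK.
- exact: s'K.
- by case/orP: h => [/s_far->|/s_far->].
- exact: s_near.
Qed.

Lemma braid_action : exists a : left_action (braid n) T,
  forall k x, a (alpha k) x = s k x.
Proof.
have act1 x : word_act (repr (1 : braid n)) x = x.
  exact: word_act_braid_eq (braid_reprK _).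
have actM (g h : braid n) x :
    word_act (repr (g * h)) x = word_act (repr g) (word_act (repr h) x).
  by rewrite -word_act_cat; apply: word_act_braid_eq (braid_reprK _).
exists (@LeftAction _ _ (fun g : braid n => word_act (repr g)) act1 actM).
move=> k x.
exact: (word_act_braid_eq _ (braid_reprK [:: (k, false)])).
Qed.
End BraidAction.

(** A point that is moved, and that returns after two or after three steps,
    has an orbit of exactly two or three points: for three steps, any
    coincidence among x, g x and g^2 x would already make x a fixed point. *)
Lemma cyclic_orbit_card23 (G : groupType) (T : finType)
    (a : left_action G T) g x :
  a g x <> x -> a g (a g x) = x \/ a g (a g (a g x)) = x ->
  #|cyclic_orbit a g x| = 2 \/ #|cyclic_orbit a g x| = 3.
Proof.
move=> gx per.
have gK y : a g^-1 (a g y) = y by rewrite -actM mulVg act1.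
have subO (A : {set T}) : x \in A -> (forall y, y \in A -> a g y \in A) ->
    (forall y, y \in A -> a g^-1 y \in A) -> cyclic_orbit a g x \subset A.
  move=> xA gA g'A; apply/subsetP => y; rewrite inE => /asboolP[h [m hm] ->].
  case: hm => ->; last rewrite -expVgn.
    by elim: m => [|m IH]; rewrite ?act1 // expgS actM gA.
  by elim: m => [|m IH]; rewrite ?act1 // expgS actM g'A.
have inO m : a (g ^+ m) x \in cyclic_orbit a g x.
  by rewrite inE; apply/asboolP; exists (g ^+ m) => //; exists m; left.
have O0 : x \in cyclic_orbit a g x by have := inO 0; rewrite act1.
have O1 : a g x \in cyclic_orbit a g x by have := inO 1%N; rewrite expg1.
have O2 : a g (a g x) \in cyclic_orbit a g x.
  by have := inO 2; rewrite expgS expg1 actM.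
case: per => per; [left | right].
  have -> : cyclic_orbit a g x = [set x; a g x].
    apply/eqP; rewrite eqEsubset; apply/andP; split; last first.
      by apply/subsetP => y; rewrite in_set2 => /orP[]/eqP->.
    apply: subO => [|y|y]; rewrite !inE ?eqxx //.
      by case/orP=> /eqP->; rewrite ?per eqxx ?orbT.
    have gVx : a g^-1 x = a g x by rewrite -{1}per gK.
    by case/orP=> /eqP->; rewrite ?gK ?gVx eqxx ?orbT.
  by rewrite cards2; case: eqP => // /esym.
have ne : uniq [:: x; a g x; a g (a g x)].
  rewrite /= !inE negb_or -!andbA; apply/and4P; split=> //; apply/eqP.
  - by move=> e; apply: gx; rewrite -e.
  - by move=> e; apply: gx; rewrite {1}e.
  - by move=> /(congr1 (a g^-1)); rewrite !gK => e; apply: gx; rewrite -e.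
have -> : cyclic_orbit a g x = [set y in [:: x; a g x; a g (a g x)]].
  apply/eqP; rewrite eqEsubset; apply/andP; split; last first.
    by apply/subsetP => y; rewrite in_set !in_cons orbF => /or3P[]/eqP->.
  apply: subO => [|y|y]; rewrite !inE ?eqxx //.
    by case/or3P=> /eqP->; rewrite ?per eqxx ?orbT.
  have gVx : a g^-1 x = a g (a g x) by rewrite -{1}per gK.
  by case/or3P=> /eqP->; rewrite ?gK ?gVx eqxx ?orbT.
by rewrite cardsE; apply/card_uniqP.
Qed.

(** * Hurwitz moves *)

Section Hurwitz.
Variable G : groupType.
Implicit Types (x y : G) (s : seq G).

Definition mulseq s : G := \prod_(t <- s) t.
Lemma mulseq_cons x s : mulseq (x :: s) = x * mulseq s.
Proof. by rewrite /mulseq big_cons. Qed.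

(** A list too short to have entries in positions k and k + 1 is left alone;
    this keeps the moves total and invertible. *)
Fixpoint hurwitz k s := match k, s with
  | 0, x :: y :: s' => x * y * x^-1 :: x :: s'
  | k'.+1, x :: s' => x :: hurwitz k' s'
  | _, _ => s
  end.

Fixpoint hurwitz_inv k s := match k, s with
  | 0, x :: y :: s' => y :: y^-1 * x * y :: s'
  | k'.+1, x :: s' => x :: hurwitz_inv k' s'
  | _, _ => s
  end.

Lemma hurwitzK k : cancel (hurwitz k) (hurwitz_inv k).
Proof.
elim: k => [|k IH] [|x s] //=; last by rewrite IH.
by case: s => [|y s] //=; rewrite !mulgA mulVg mul1g mulgVK.
Qed.

Lemma hurwitz_invK k : cancel (hurwitz_inv k) (hurwitz k).
Proof.
elim: k => [|k IH] [|x s] //=; last by rewrite IH.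
by case: s => [|y s] //=; rewrite !mulgA mulgV mul1g mulgK.
Qed.

Lemma size_hurwitz k s : size (hurwitz k s) = size s.
Proof. by elim: k s => [|k IH] [|x [|y s]] //=; rewrite IH. Qed.

Lemma size_hurwitz_inv k s : size (hurwitz_inv k s) = size s.
Proof. by rewrite -[in RHS](hurwitz_invK k s) size_hurwitz. Qed.

Lemma mulseq_hurwitz k s : mulseq (hurwitz k s) = mulseq s.
Proof.
elim: k s => [|k IH] [|x s] //=; last by rewrite !mulseq_cons IH.
by case: s => [|y s] //=; rewrite !mulseq_cons !mulgA mulgVK.
Qed.

Lemma mulseq_hurwitz_inv k s : mulseq (hurwitz_inv k s) = mulseq s.
Proof. by rewrite -[in RHS](hurwitz_invK k s) mulseq_hurwitz. Qed.

Lemma all_hurwitz (P : pred G) k s : (forall x y, P x -> P (x ^ y)) ->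
  all P s -> all P (hurwitz k s).
Proof.
move=> PJ; elim: k s => [|k IH] [|x s] //=; last by case/andP=> -> /IH.
case: s => [|y s] //= /and3P[Px Py Ps]; rewrite Px Ps.
by have := PJ y x^-1 Py; rewrite conjgE invgK mulgA => ->.
Qed.

Lemma all_hurwitz_inv (P : pred G) k s : (forall x y, P x -> P (x ^ y)) ->
  all P s -> all P (hurwitz_inv k s).
Proof.
move=> PJ; elim: k s => [|k IH] [|x s] //=; last by case/andP=> -> /IH.
case: s => [|y s] //= /and3P[Px Py Ps]; rewrite Py Ps.
by have := PJ x y Px; rewrite conjgE mulgA => ->.
Qed.

Lemma hurwitz_far k m s : k.+1 < m ->
  hurwitz k (hurwitz m s) = hurwitz m (hurwitz k s).
Proof.
elim: k m s => [|k IH] [|m] [|x s] //= lt; last by rewrite IH.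
by case: m lt => // m _; case: s.
Qed.

Lemma hurwitz_near k s : k.+2 < size s ->
  hurwitz k (hurwitz k.+1 (hurwitz k s)) =
  hurwitz k.+1 (hurwitz k (hurwitz k.+1 s)).
Proof.
elim: k s => [|k IH] [|x s] //= lt; last by congr (_ :: _); apply: IH.
case: s lt => [|y [|z s]] //= _.
by rewrite !mulgA invgM invgM invgK !mulgA !mulgVK.
Qed.

(** A move at x, y yields x y x^-1, x, which is x, y only if x = y. *)
Lemma hurwitz_fixed_repeat k s : k.+1 < size s -> hurwitz k s = s ->
  exists s1 t s2, s = s1 ++ t :: t :: s2.
Proof.
elim: k s => [|k IH] [|x s] //=; last first.
  by move=> /IH h [/h[s1 [t [s2 ->]]]]; exists (x :: s1), t, s2.
by case: s => [|y s] //= _ [_ ->]; exists [::], y, s.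
Qed.

(** If x, y commute, two moves give back (x, y). If they satisfy the braid
    relation, put z = x y x^-1; the moves lead from (x, y) to (z, x), (y, z)
    and back to (x, y). *)
Lemma hurwitz_periodic (P : pred G) k s :
  (forall x, P x -> x * x = 1) ->
  (forall x y, P x -> P y -> x * y = y * x \/ x * y * x = y * x * y) ->
  all P s -> hurwitz k (hurwitz k s) = s \/
             hurwitz k (hurwitz k (hurwitz k s)) = s.
Proof.
move=> P2 PP; elim: k s => [|k IH] [|x s] //=; try by left.
  case: s => [|y s] /=; first by left.
  case/and3P=> Px Py _; have xx := P2 x Px; have yy := P2 y Py.
  case: (PP x y Px Py) => [xy|xyx]; first by left; rewrite xy mulgK -xy mulgK.
  right; have xV : x^-1 = x by rewrite -[LHS]mulg1 -xx mulgA mulVg mul1g.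
  have yV : y^-1 = y by rewrite -[LHS]mulg1 -yy mulgA mulVg mul1g.
  set z := x * y * x^-1; have zE : z = x * y * x by rewrite /z xV.
  have zV : z^-1 = z by rewrite zE !invgM xV yV mulgA.
  have zxz : z * x * z^-1 = y.
    rewrite zV {1}zE -(mulgA _ x x) xx mulg1 zE xyx !mulgA.
    by rewrite -(mulgA x y y) yy mulg1 xx mul1g.
  rewrite zxz; congr [:: _, _ & _].
  by rewrite yV zE xyx !mulgA yy mul1g -mulgA yy mulg1.
by case/andP=> _ /IH[] e; [left | right]; rewrite e.
Qed.

End Hurwitz.

(** * Increasing cycles, cuts and parking words *)

Definition is_equivalence (T : Type) (E : rel T) :=
  [/\ reflexive E, symmetric E & transitive E].

Lemma equivalence_eqr (T : Type) (E : rel T) x y z :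
  is_equivalence E -> E x y -> E x z = E y z.
Proof.
move=> [_ Es Et] xy; apply/idP/idP; last exact: Et.
by apply: Et; rewrite Es.
Qed.

Section Blocks.
Variable N : nat.
Implicit Types (E : rel 'I_N) (w : {perm 'I_N}) (f s : seq 'I_N) (a b x : 'I_N).

(** The permutation w maps each x to its cyclic successor in its E-block: the
    next larger element, or the least one if x is the largest. *)
Definition cyclic_succ E w := forall x, E x (w x) /\
  forall y, E x y -> (x < w x) && ((y <= x) || (w x <= y)) || (w x <= y <= x).

(** On the list of all points this is the rank of x in its block. *)
Definition block_cnt E f (x : 'I_N) := count (fun z => E x z && (z <= x)) f.

Definition nonmax E x := [exists y, E x y && (x < y)].

(** On the one-block relation this is the condition on parking functions. The
    value at the maximum of a block B says that B carries #|B| - 1 labels, as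
    many as there are transpositions in a minimal factorization of a cycle on
    B. *)
Definition block_parking E f := forall x : 'I_N,
  if nonmax E x
  then block_cnt E (enum 'I_N) x <= block_cnt E f x
  else block_cnt E (enum 'I_N) x == (block_cnt E f x).+1.

(** The elements of ]a, b] in the block of a become a block of their own; all
    other blocks, and the rest of that block, remain. *)
Definition cut E (a b : 'I_N) : rel 'I_N := fun x y =>
  E x y && (E a x ==> ((a < x <= b) == (a < y <= b))).

Lemma cut_equivalence E a b : is_equivalence E -> is_equivalence (cut E a b).
Proof.
move=> eqE; have [Er Es Et] := eqE; split.
- by move=> x; rewrite /cut Er eqxx implybT.
- move=> x y; rewrite /cut Es; case yx: (E y x) => //=.
  by rewrite Es -(equivalence_eqr a eqE yx) Es eq_sym.
- move=> y x z; rewrite /cut => /andP[xy axy] /andP[yz ayz].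
  rewrite (Et _ _ _ xy yz) /=; apply/implyP => ax.
  have ay: E a y by exact: Et ax xy.
  by move: axy ayz; rewrite ax ay /= => /eqP-> /eqP->.
Qed.

(** Multiplying by (a b) only exchanges the images of a and b: the arc of the
    cycle after a and up to b closes up, and a now precedes what followed b.
    *)
Lemma cut_succ E w a b : is_equivalence E -> cyclic_succ E w ->
  a < b -> E a b -> cyclic_succ (cut E a b) (tperm a b * w).
Proof.
move=> eqE sw ab Eab x; have [Er Es Et] := eqE.
have Eba : E b a by rewrite Es.
rewrite permM; case: tpermP => [->|->|/eqP xa /eqP xb].
- have [Ebw bw] := sw b.
  have ba := bw _ Eba; have bb := bw _ (Er b).
  split.
    by rewrite /cut (Et _ _ _ Eab Ebw) ltnn; apply/implyP=> _; lia.
  move=> y; rewrite /cut Er ltnn /= => /andP[Eay ay].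
  by have := bw _ (Et _ _ _ Eba Eay); lia.
- have [Eaw aw] := sw a.
  have ab' := aw _ Eab; have aa := aw _ (Er a).
  split; first by rewrite /cut (Et _ _ _ Eba Eaw) Eab /=; lia.
  move=> y; rewrite /cut Eab /= => /andP[Eby ay].
  by have := aw _ (Et _ _ _ Eab Eby); lia.
- have [Exw xw] := sw x.
  split.
    rewrite /cut Exw; apply/implyP => Eax.
    have Exa : E x a by rewrite Es.
    have ha := xw _ Exa; have hb := xw _ (Et _ _ _ Exa Eab).
    by move: xa xb; rewrite -!val_eqE /=; lia.
  by move=> y /andP[xy _]; apply: xw.
Qed.

Lemma block_cnt_cons E f a x :
  block_cnt E (a :: f) x = (E x a && (a <= x)) + block_cnt E f x.
Proof. by []. Qed.

Lemma cut_cnt_out E a b s x : ~~ E a x ->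
  block_cnt (cut E a b) s x = block_cnt E s x.
Proof. by move=> /negbTE ax; apply: eq_count => z; rewrite /cut ax andbT. Qed.

Lemma cut_cnt_lo E a b s x : E a x -> x <= a ->
  block_cnt (cut E a b) s x = block_cnt E s x.
Proof.
by move=> ax xa; apply: eq_count => z; rewrite /cut ax /=; case: (E x z); lia.
Qed.

Lemma cut_cnt_mid E a b s x : is_equivalence E -> E a x -> a < x <= b ->
  block_cnt (cut E a b) s x + block_cnt E s a = block_cnt E s x.
Proof.
move=> eqE ax xa; rewrite -count_predUI addnC.
rewrite (@eq_count _ _ pred0) ?count_pred0.
  apply: eq_count => z /=; rewrite /cut ax (equivalence_eqr _ eqE ax) /=.
  by case: (E x z); lia.
move=> z /=; rewrite /cut ax (equivalence_eqr _ eqE ax) /=.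
by case: (E x z); lia.
Qed.

(** Above b the rank drops by the number of entries that moved to the new
    block, those in ]a, b]. *)
Lemma cut_cnt_hi E a b s x : is_equivalence E -> E a x -> E a b -> a < b < x ->
  block_cnt (cut E a b) s x + block_cnt E s b =
  block_cnt E s x + block_cnt E s a.
Proof.
move=> eqE ax ab bx; elim: s => // z s IHs.
have : cut E a b x z && (z <= x) + (E b z && (z <= b)) =
       (E x z && (z <= x)) + (E a z && (z <= a)).
  rewrite /cut ax -(equivalence_eqr _ eqE ax) -(equivalence_eqr _ eqE ab) /=.
  by case: (E a z); lia.
by move: IHs; rewrite !block_cnt_cons; lia.
Qed.

Lemma nonmaxI E x y : E x y -> x < y -> nonmax E x.
Proof. by move=> xy lt; apply/existsP; exists y; rewrite xy. Qed.

Lemma cut_nonmax E a b : is_equivalence E -> E a b -> a < b ->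
  [/\ nonmax (cut E a b) b = false,
      nonmax (cut E a b) a = nonmax E b,
      forall x, E a x -> x < a -> nonmax (cut E a b) x,
      forall x, E a x -> a < x < b -> nonmax (cut E a b) x &
      forall x, (E a x -> b < x) -> nonmax (cut E a b) x = nonmax E x].
Proof.
move=> eqE ab lt; have [Er Es Et] := eqE; split.
- apply/existsP => -[y]; rewrite /cut ab /=; lia.
- apply/existsP/existsP => -[y]; rewrite /cut.
    move=> /andP[/andP[ay h] ly]; exists y; move: h.
    by rewrite -(equivalence_eqr _ eqE ab) ay Er /=; lia.
  move=> /andP[yb ly]; exists y.
  by rewrite (equivalence_eqr _ eqE ab) yb Er /=; lia.
- move=> x ax lx; apply: (@nonmaxI _ _ a) => //.
  by rewrite /cut Es ax /=; lia.
- move=> x ax lx; apply: (@nonmaxI _ _ b); last lia.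
  by rewrite /cut -(equivalence_eqr _ eqE ax) ab ax; lia.
- move=> x ax; apply: eq_existsb => y; rewrite /cut.
  by case: (E a x) ax => /= [/(_ isT)|]; lia.
Qed.

(** Let K be the rank in the block and F the number of labels of f up to a
    point. Both parking conditions compare K with F, and the cut shifts the
    two counts in the same way above b, where the labels in ]a, b] are one
    fewer than the elements but the label a is dropped too. Inside ]a, b] the
    condition after the cut is the ballot condition of the last two clauses.
    At the point a the cut removes a label; whether a becomes a maximum is
    decided by whether b was one. *)
Lemma block_parking_cut E a b f : is_equivalence E -> E a b -> a < b ->
  block_parking (cut E a b) f <->
  [/\ block_parking E (a :: f),
      forall y, E a y -> a < y < b ->
        block_cnt E (enum 'I_N) y + block_cnt E f a <=
        block_cnt E f y + block_cnt E (enum 'I_N) a &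
      block_cnt E (enum 'I_N) b + block_cnt E f a =
      (block_cnt E f b + block_cnt E (enum 'I_N) a).+1].
Proof.
move=> eqE ab lt; have [Er Es Et] := eqE.
have [nb na nlo nmid nhi] := cut_nonmax eqE ab lt.
have out s := @cut_cnt_out E a b s.
have lo s := @cut_cnt_lo E a b s.
have mid s := fun x => @cut_cnt_mid E a b s x eqE.
have hi s := fun x => @cut_cnt_hi E a b s x eqE.
rewrite /block_parking.
move: (block_cnt_cons E f a) (out f) (out (enum 'I_N)) (lo f) (lo (enum 'I_N))
  (mid f) (mid (enum 'I_N)) (hi f) (hi (enum 'I_N)) => {out lo mid hi}.
move: (block_cnt E f) (block_cnt (cut E a b) f) => F F'.
move: (block_cnt E (a :: f)) => G.
move: (block_cnt E (enum 'I_N)) (block_cnt (cut E a b) (enum 'I_N)) => K K'.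
move=> consG outF outK loF loK midF midK hiF hiK.
have Eba : E b a by rewrite Es.
have lab : a < b <= b by rewrite lt leqnn.
have nma : nonmax E a by apply: nonmaxI lt.
have aF := loF a (Er a) (leqnn a); have aK := loK a (Er a) (leqnn a).
have bF := midF b ab lab; have bK := midK b ab lab.
have Ga := consG a; rewrite Er leqnn in Ga.
have Gb := consG b; rewrite Eba (ltnW lt) in Gb.
split=> [P | [P m eb] x].
  have Pb := P b; rewrite nb in Pb.
  have Pa := P a; rewrite na in Pa.
  split; last first.
  - by lia.
  - move=> y ay ly; have := P y; rewrite nmid //.
    have ly' : a < y <= b by lia.
    by move: (midF y ay ly') (midK y ay ly'); lia.
  move=> x; rewrite consG Es; have Px := P x.
  case ax: (E a x); last first.
    by move: Px; rewrite outF ?outK ?ax // nhi ?ax.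
  case: (ltngtP x a) => xa /=.
  - move: Px; rewrite nlo // loF ?loK ?(ltnW xa) //.
    by rewrite (nonmaxI _ xa) // Es.
  - case: (ltngtP x b) => xb.
    + rewrite nmid ?xa // in Px.
      have lx : a < x <= b by lia.
      rewrite (nonmaxI _ xb).
        by move: (midF x ax lx) (midK x ax lx) Pa; case: ifP; lia.
      by rewrite -(equivalence_eqr _ eqE ax).
    + rewrite nhi // in Px.
      have lx : a < b < x by lia.
      by move: (hiF x ax ab lx) (hiK x ax ab lx) Px; case: ifP; lia.
    + by rewrite (val_inj xb); move: Pa; case: ifP; lia.
  - by rewrite (val_inj xa) nma; move: Pa; case: ifP; lia.
have Px := P x; rewrite consG Es in Px.
case ax: (E a x); last first.
  by move: Px; rewrite ax outF ?outK ?ax // nhi ?ax.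
rewrite ax /= in Px.
case: (ltngtP x a) => xa /=.
- rewrite nlo // loF ?loK ?(ltnW xa) //.
  by move: Px; rewrite (nonmaxI _ xa) 1?Es //; lia.
- case: (ltngtP x b) => xb.
  + rewrite nmid ?xa //.
    have lx : a < x <= b by lia.
    by move: (midF x ax lx) (midK x ax lx) (m x ax); lia.
  + rewrite nhi //.
    have lx : a < b < x by lia.
    by move: (hiF x ax ab lx) (hiK x ax ab lx) Px; case: ifP; lia.
  + by rewrite (val_inj xb) nb; lia.
- rewrite (val_inj xa) na.
  have := P b; have := P a; rewrite nma; case: ifP; lia.
Qed.

(** The end of the cut is the first point where the ballot condition fails. *)
Lemma cut_unique E a b1 b2 f : is_equivalence E -> E a b1 -> E a b2 ->
  a < b1 -> a < b2 -> block_parking (cut E a b1) f ->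
  block_parking (cut E a b2) f -> b1 = b2.
Proof.
move=> eqE ab1 ab2 lt1 lt2 /(block_parking_cut f eqE ab1 lt1) P1.
move=> /(block_parking_cut f eqE ab2 lt2) P2.
case: P1 P2 => [_ + +] [_ + +].
move: (block_cnt E (enum 'I_N)) (block_cnt E f) => M K h1 e1 h2 e2.
apply/val_inj/eqP; rewrite eqn_leq (leqNgt b1) (leqNgt b2); apply/andP.
split; apply/negP => lt.
  by move: (h1 b2 ab2); rewrite lt lt2; lia.
by move: (h2 b1 ab1); rewrite lt lt1; lia.
Qed.

Lemma block_cnt_mono E f x y : is_equivalence E -> E x y -> x <= y ->
  block_cnt E f x <= block_cnt E f y.
Proof.
move=> eqE xy le; apply: sub_count => z /=.
by rewrite (equivalence_eqr _ eqE xy) => /andP[-> /leq_trans->].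
Qed.

Lemma block_cnt_pred E x : is_equivalence E ->
  (block_cnt E (enum 'I_N) x = 1%N /\ forall y, E x y -> x <= y) \/
  exists p, [/\ E x p, p < x, forall y, E x y -> y < x -> y <= p &
    block_cnt E (enum 'I_N) x = (block_cnt E (enum 'I_N) p).+1].
Proof.
move=> eqE; have [Er Es Et] := eqE.
case: (pickP (fun y => E x y && (y < x))) => [y0 y0P | no]; [right | left].
  case: (@arg_maxnP _ y0 (fun y => E x y && (y < x)) val y0P) => p.
  move=> /andP[xp px] pmax.
  have pm y : E x y -> y < x -> y <= p by move=> xy yx; apply: pmax; rewrite xy.
  exists p; split=> //.
  rewrite /block_cnt -addn1 -[1%N in RHS](_ : count_mem x (enum 'I_N) = 1%N).
    rewrite -count_predUI addnC (@eq_count _ (predI _ _) pred0) ?count_pred0.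
      apply: eq_count => z /=; rewrite (equivalence_eqr _ eqE xp).
      rewrite -val_eqE /=; case xz: (E p z) => /=; last first.
        by apply/esym/eqP => zx; rewrite (val_inj zx) Es xp in xz.
      by have := pm z; rewrite (equivalence_eqr _ eqE xp) xz; lia.
    by move=> z /=; rewrite -val_eqE /=; case: (E p z) => //=; lia.
  by rewrite count_uniq_mem ?enum_uniq ?mem_enum.
split=> [|y xy]; last by have := no y; rewrite xy /= ltnNge => /negbFE.
rewrite /block_cnt (@eq_count _ _ (pred1 x)).
  by rewrite count_uniq_mem ?enum_uniq ?mem_enum.
move=> z /=; have := no z; rewrite -val_eqE /=.
case xz: (E x z) => /=; first lia.
by move=> _; apply/esym/eqP => zx; rewrite (val_inj zx) Er in xz.
Qed.

(** The ballot condition fails at the maximum of the block, because of the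
    value that parking words take there; let b be the first failure. From one
    element of the block to the next the rank grows by one and the label count
    does not decrease, so at b the labels are behind by exactly one. *)
Lemma cut_exists E a f : is_equivalence E -> block_parking E (a :: f) ->
  exists b : 'I_N, [/\ E a b, a < b & block_parking (cut E a b) f].
Proof.
move=> eqE P; have [Er Es Et] := eqE.
pose K := block_cnt E (enum 'I_N); pose F := block_cnt E f.
(* A label at the maximum of its block would leave too few labels below it. *)
have nma : nonmax E a.
  apply: contraT => nma; have := P a.
  rewrite (negbTE nma) block_cnt_cons Er leqnn.
  case: (block_cnt_pred a eqE) => [[-> _] //|[p [ap pa _ ->]]].
  have pa' : E p a by rewrite Es.
  have := P p; rewrite (nonmaxI pa' pa) block_cnt_cons (leqNgt a p) pa andbF.
  have := block_cnt_mono f eqE pa' (ltnW pa).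
  by move: (block_cnt E _ _) (block_cnt E _ _) (block_cnt E _ _); lia.
have [m am mmax] : exists2 m, E a m & forall y, E a y -> y <= m.
  by case: (@arg_maxnP _ a (E a) val (Er a)) => m am mm; exists m.
have lam : a < m.
  by case/existsP: nma => y /andP[ay ly]; have := mmax y ay; lia.
have Pm : [&& E a m, a < m & F m + K a < K m + F a].
  rewrite am lam /=; have := P a; have := P m; rewrite nma.
  have -> : nonmax E m = false.
    apply/existsP => -[y /andP[my ly]].
    by have := mmax y (Et _ _ _ am my); lia.
  rewrite !block_cnt_cons Er Es am leqnn (ltnW lam) -/K -/F.
  by move: (K) (F); lia.
case: (@arg_minnP _ m
  (fun y => [&& E a y, a < y & F y + K a < K y + F a]) val Pm) => b.
move=> /and3P[ab lab Cb] bmin.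
exists b; split=> //; apply/block_parking_cut => //; rewrite -/K -/F.
have ballot y : E a y -> a < y < b -> K y + F a <= F y + K a.
  move=> ay /andP[lay lyb]; rewrite leqNgt; apply/negP => Cy.
  by have := bmin y; rewrite ay lay Cy => /(_ isT); rewrite leqNgt lyb.
split=> //.
case: (block_cnt_pred b eqE) => [[_]|[p [bp pb pm]]].
  by move/(_ a); rewrite Es ab; lia.
rewrite -/K => Kb; have lap : a <= p by apply: pm; rewrite 1?Es.
have pb' : E p b by rewrite Es.
have := block_cnt_mono f eqE pb' (ltnW pb); rewrite -/F.
have : K p + F a <= F p + K a.
  case: (ltngtP a p) lap => // [lt _|/val_inj <- _]; last by rewrite addnC.
  by apply: ballot; rewrite ?lt //; apply: Et ab bp.
by move: Cb Kb; move: (K) (F) => ? ?; lia.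
Qed.

End Blocks.

(** * Minimal factorizations into transpositions *)

Section Factorizations.
Variable N : nat.
Implicit Types (E : rel 'I_N) (w : {perm 'I_N}) (T : seq ('I_N * 'I_N)).
Implicit Types (a b x y : 'I_N).

Definition increasing T := all (fun p : 'I_N * 'I_N => p.1 < p.2) T.
Definition transpositions T : seq {perm 'I_N} := [seq tperm p.1 p.2 | p <- T].
(** Multiplication by a transposition changes the number of cycles by at most
    one, and the identity has N cycles. *)
Lemma porbits_transpositions T :
  N <= #|porbits (mulseq (transpositions T))| + size T.
Proof.
elim: T => [|[a b] T IH] /=.
  rewrite /mulseq big_nil addn0 -[X in X <= _]card_ord /porbits card_imset //.
  move=> x y /setP/(_ y); rewrite porbit_id => /porbitP[i].
  by rewrite expg1n perm1 => ->.
move: IH; rewrite mulseq_cons.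
have := porbits_mul_tperm (mulseq (transpositions T)) a b => /=.
set p := #|porbits (_ * _)|; set q := #|porbits (mulseq _)|.
move: p q => p q.
case: eqVneq => [->|_] /=; first by rewrite porbit_id /=; lia.
case: (_ \notin _) => /=; lia.
Qed.

Lemma porbit_block E w x y : is_equivalence E -> cyclic_succ E w ->
  y \in porbit w x -> E x y.
Proof.
move=> [Er Es Et] sw /porbitP[i ->] {y}; elim: i => [|i IH].
  by rewrite perm1.
by rewrite expgSr permM; apply: Et IH (sw _).1.
Qed.

(** If a and b were in different cycles of w, then (a b) w would have one
    cycle less than w, too few for a product of size T transpositions. *)
Lemma minimal_cons E w a b T : is_equivalence E -> cyclic_succ E w ->
  a < b -> mulseq (transpositions ((a, b) :: T)) = w ->
  #|porbits w| + (size T).+1 <= N ->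
  [/\ E a b, mulseq (transpositions T) = tperm a b * w &
      #|porbits (tperm a b * w)| + size T <= N].
Proof.
move=> eqE sw ab; rewrite /= mulseq_cons => pw.
have pT : mulseq (transpositions T) = tperm a b * w.
  by rewrite -pw mulgA tperm2 mul1g.
have := porbits_transpositions T; have := porbits_mul_tperm w a b.
rewrite pT; case: (boolP (a \in porbit w b)) => [abw|_] /=.
  have [_ Es _] := eqE.
  rewrite Es (porbit_block eqE sw abw).
  move=> h1 h2 h3; split=> //; move: h1 h2 h3.
  move: #|porbits (tperm a b * w)| #|porbits w| => p q.
  by case: (_ != _) => /=; lia.
have -> : a != b by rewrite -val_eqE /=; lia.
by move: #|porbits (tperm a b * w)| #|porbits w| => p q /=; lia.
Qed.

Lemma minimal_factorization_parking E w T : is_equivalence E ->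
  cyclic_succ E w -> increasing T -> mulseq (transpositions T) = w ->
  #|porbits w| + size T <= N -> block_parking E (unzip1 T).
Proof.
elim: T E w => [|[a b] T IH] E w eqE sw.
  rewrite /= /mulseq big_nil => _ w1 _ x; have [Er Es Et] := eqE.
  subst w.
  have E1 y : E x y -> x = y.
    move=> xy; have := (sw x).2 y xy.
    by rewrite perm1 ltnn /= -eqn_leq => /eqP/val_inj.
  have -> : nonmax E x = false.
    by apply/existsP => -[y /andP[/E1 ->]]; rewrite ltnn.
  rewrite /block_cnt (@eq_count _ _ (pred1 x)).
    by rewrite count_uniq_mem ?enum_uniq ?mem_enum.
  move=> z /=; apply/andP/eqP => [[/E1 -> //]| ->]; by rewrite Er.
move=> /andP[/= ab inc] pw sz.
have [Eab pT sz'] := minimal_cons eqE sw ab pw sz.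
have eqE' := cut_equivalence a b eqE.
have := IH _ _ eqE' (cut_succ eqE sw ab Eab) inc pT sz'.
by case/(block_parking_cut _ eqE Eab ab).
Qed.

(** The tail of a minimal factorization is one for the cut permutation, hence
    its labels are parking after the cut; this determines the end b of the
    cut. *)
Lemma minimal_factorization_unique E w T1 T2 : is_equivalence E ->
  cyclic_succ E w -> increasing T1 -> increasing T2 ->
  mulseq (transpositions T1) = w -> mulseq (transpositions T2) = w ->
  #|porbits w| + size T1 <= N -> unzip1 T1 = unzip1 T2 -> T1 = T2.
Proof.
elim: T1 T2 E w => [|[a b1] T1 IH] [|[a' b2] T2] E w eqE sw //.
move=> /andP[/= ab1 inc1] /andP[/= ab2 inc2] p1 p2 sz [ea eT]; subst a'.
have sT : size T1 = size T2.
  by have := congr1 size eT; rewrite !size_map.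
have [Eab1 pT1 sz1] := minimal_cons eqE sw ab1 p1 sz.
have [Eab2 pT2 sz2] : [/\ E a b2, mulseq (transpositions T2) = tperm a b2 * w &
      #|porbits (tperm a b2 * w)| + size T2 <= N].
  by apply: minimal_cons p2 _ => //; rewrite -sT.
have eqE1 := cut_equivalence a b1 eqE; have sw1 := cut_succ eqE sw ab1 Eab1.
have eqE2 := cut_equivalence a b2 eqE; have sw2 := cut_succ eqE sw ab2 Eab2.
have P1 := minimal_factorization_parking eqE1 sw1 inc1 pT1 sz1.
have := minimal_factorization_parking eqE2 sw2 inc2 pT2 sz2.
rewrite -eT => P2; have eb := cut_unique eqE Eab1 Eab2 ab1 ab2 P1 P2; subst b2.
by rewrite (IH T2 _ _ eqE1 sw1).
Qed.

(** Read the labels from the left and perform the cut that each of them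
    determines; when no label remains all blocks are singletons. *)
Lemma parking_factorization_exists E w f : is_equivalence E ->
  cyclic_succ E w -> block_parking E f ->
  exists T, [/\ unzip1 T = f, increasing T & mulseq (transpositions T) = w].
Proof.
elim: f E w => [|a f IH] E w eqE sw P; have [Er Es Et] := eqE.
  exists [::]; split; rewrite // /mulseq big_nil; apply/permP => x.
  have nomax y : nonmax E y = false.
    case nm: (nonmax E y) => //; have := P y; rewrite nm /=.
    by case: (block_cnt_pred y eqE) => [[-> _]|[p [_ _ _ ->]]].
  have E1 y : E x y -> y = x.
    move=> xy; have yx : E y x by rewrite Es.
    case: (ltngtP x y) => [lt|lt|/val_inj //].
      by have := nonmaxI xy lt; rewrite nomax.
    by have := nonmaxI yx lt; rewrite nomax.
  by rewrite perm1 (E1 _ (sw x).1).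
have [b [Eab ab Pb]] := cut_exists eqE P.
have [T [<- inc pT]] :=
  IH _ _ (cut_equivalence a b eqE) (cut_succ eqE sw ab Eab) Pb.
exists ((a, b) :: T); split=> //=; first by rewrite ab.
by rewrite mulseq_cons pT mulgA tperm2 mul1g.
Qed.

End Factorizations.

Section Transpositions.
Variable N : nat.
Implicit Types (a b x y : 'I_N) (s : seq {perm 'I_N}) (t u : {perm 'I_N}).

Definition is_transposition t :=
  [exists p : 'I_N * 'I_N, (p.1 < p.2) && (t == tperm p.1 p.2)].

Lemma is_transpositionP t :
  reflect (exists a b, a != b /\ t = tperm a b) (is_transposition t).
Proof.
apply: (iffP existsP) => [[[a b] /andP[/= ab /eqP->]]|[a [b [ab ->]]]].
  by exists a, b; rewrite -val_eqE /=; split=> //; lia.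
case: (ltngtP a b) => [lt|lt|/val_inj e]; last by rewrite e eqxx in ab.
  by exists (a, b); rewrite lt eqxx.
by exists (b, a); rewrite lt tpermC eqxx.
Qed.

Lemma is_transpositionJ t u : is_transposition t -> is_transposition (t ^ u).
Proof.
move/is_transpositionP => [a [b [ab ->]]]; rewrite tpermJ.
by apply/is_transpositionP; exists (u a), (u b); rewrite (inj_eq perm_inj).
Qed.

Lemma transposition_sq t : is_transposition t -> t * t = 1.
Proof. by move/is_transpositionP => [a [b [_ ->]]]; exact: tperm2. Qed.

(** Two transpositions are equal, disjoint or share one point; in the last
    case both sides of the braid relation are the transposition of the two
    other points. *)
Lemma transposition_braid t u : is_transposition t -> is_transposition u ->
  t * u = u * t \/ t * u * t = u * t * u.
Proof.
have shared x y z : x != y -> x != z -> y != z ->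
    tperm x y * tperm x z * tperm x y = tperm x z * tperm x y * tperm x z.
  move=> xy xz yz.
  have := tpermJ x z (tperm x y); have := tpermJ x y (tperm x z).
  have zy : z != y by rewrite eq_sym.
  rewrite !conjgE !tpermV !tpermL (tpermD xz yz) (tpermD xy zy) !mulgA => -> ->.
  exact: tpermC.
move=> /is_transpositionP[a [b [ab ->]]] /is_transpositionP[c [d [cd ->]]].
have [eac|ac] := eqVneq a c.
  subst c; have [<-|bd] := eqVneq b d; [by left | right; exact: shared].
have [ead|ad] := eqVneq a d.
  subst d; have [<-|bc] := eqVneq b c; first by left; rewrite tpermC.
  by right; rewrite (tpermC c a); apply: shared.
have [ebc|bc] := eqVneq b c.
  subst c; right; rewrite (tpermC a b).
  by apply: shared => //; rewrite eq_sym.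
have [ebd|bd] := eqVneq b d.
  subst d; right; rewrite (tpermC a b) (tpermC c b).
  by apply: shared => //; rewrite eq_sym.
left; have := tpermJ c d (tperm a b); rewrite !tpermD //.
by rewrite conjgE tpermV => {2}<-; rewrite -!mulgA tperm2 mulg1.
Qed.

Lemma tperm_lt_inj a b a' b' : a < b -> a' < b' ->
  tperm a b = tperm a' b' -> (a, b) = (a', b').
Proof.
move=> ab ab' e.
have := tpermL a b; rewrite e; case: tpermP => [-> <- //|ab1 ab2|_ _ ab2].
  by rewrite ab1 -ab2 in ab; lia.
by rewrite ab2 ltnn in ab.
Qed.

Lemma transpositions_inj (T1 T2 : seq ('I_N * 'I_N)) :
  increasing T1 -> increasing T2 ->
  transpositions T1 = transpositions T2 -> T1 = T2.
Proof.
elim: T1 T2 => [|[a b] T1 IH] [|[a' b'] T2] //= /andP[ab i1] /andP[ab' i2].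
by case=> /(tperm_lt_inj ab ab') -> /(IH _ i1 i2) ->.
Qed.

Lemma all_transpositionP s :
  reflect (exists2 T, increasing T & s = transpositions T)
    (all is_transposition s).
Proof.
apply: (iffP idP) => [|[T iT ->]].
  elim: s => [|t s IH] /=; first by exists [::].
  move=> /andP[/existsP[p /andP[lt /eqP->]] /IH[T iT ->]].
  by exists (p :: T); rewrite //= lt.
rewrite all_map; apply: sub_all iT => p lt /=.
by apply/existsP; exists p; rewrite lt eqxx.
Qed.

End Transpositions.

(** * Factorizations of the long cycle and parking functions *)

Section LongCycle.
Variable n : nat.

Definition long_cycle : {perm 'I_n.+1} := perm (@ordS_inj n.+1).

Definition top_rel : rel 'I_n.+1 := fun _ _ => true.

Lemma top_equivalence : is_equivalence top_rel.
Proof. by split. Qed.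

Lemma long_cycle_succ : cyclic_succ top_rel long_cycle.
Proof.
move=> x; split=> // y _; rewrite permE /=.
have [xn|xn] := ltnP x n; first by rewrite modn_small; lia.
have -> : x.+1 = n.+1 by have := ltn_ord x; lia.
by rewrite modnn; have := ltn_ord y; lia.
Qed.

Lemma porbits_long_cycle : #|porbits long_cycle| <= 1.
Proof.
apply: (@leq_trans #|[set porbit long_cycle ord0]|); last by rewrite cards1.
apply/subset_leq_card/subsetP => A /imsetP[x _ ->].
rewrite inE eq_sym eq_porbit_mem porbit_sym.
apply/porbitP; exists x; apply/val_inj.
have h (i : nat) : i <= n -> i = (long_cycle ^+ i) ord0 :> nat.
  elim: i => [|i IH] ile; first by rewrite perm1.
  by rewrite expgSr permM permE /= -IH ?modn_small //; lia.
exact: (h x (ltn_ord x)).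
Qed.

Definition factorization s :=
  [&& size s == n, all (@is_transposition n.+1) s & mulseq s == long_cycle].

Lemma factorization_hurwitz k s :
  factorization s -> factorization (hurwitz k s).
Proof.
case/and3P=> ss ts ps; rewrite /factorization size_hurwitz ss mulseq_hurwitz ps.
by rewrite all_hurwitz //; exact: is_transpositionJ.
Qed.

Lemma factorization_hurwitz_inv k s :
  factorization s -> factorization (hurwitz_inv k s).
Proof.
case/and3P=> ss ts ps.
rewrite /factorization size_hurwitz_inv ss mulseq_hurwitz_inv ps.
by rewrite all_hurwitz_inv //; exact: is_transpositionJ.
Qed.

(** In a fixed factorization t, t occurs in adjacent places; without them the
    one-cycle permutation would be a product of n - 2 transpositions. *)
Lemma factorization_not_fixed k s :
  k.+1 < n -> factorization s -> hurwitz k s <> s.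
Proof.
move=> kn /and3P[/eqP ss ts /eqP ps] /hurwitz_fixed_repeat[|s1 [t [s2 es]]].
  by rewrite ss.
move: ss ts ps; rewrite es size_cat all_cat /= => ss /and4P[t1 tt _ t2].
rewrite /mulseq big_cat !big_cons /= (mulgA t) transposition_sq // mul1g.
rewrite -big_cat.
have /all_transpositionP[T _ eT] : all (@is_transposition n.+1) (s1 ++ s2).
  by rewrite all_cat t1.
have := porbits_transpositions T.
rewrite -eT /mulseq => h e; move: h; rewrite e.
have := porbits_long_cycle.
have -> : size T = size (s1 ++ s2) by rewrite eT size_map.
rewrite size_cat; move: #|porbits _| (size s1) (size s2) ss => p q r; lia.
Qed.

(** The codomain grows from n to n + 1 points since the cycle c acts on n + 1
    points; the largest of them is never the smaller point of a transposition.
    *)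
Definition labels (f : {ffun 'I_n -> 'I_n}) : seq 'I_n.+1 :=
  [seq widen_ord (leqnSn n) (f i) | i <- enum 'I_n].

Lemma labels_inj : injective labels.
Proof.
move=> f g e; apply/ffunP => i.
have /eq_in_map/(_ i) := e; rewrite mem_enum => /(_ isT) /(congr1 val) /=.
exact: val_inj.
Qed.

Lemma block_cnt_enum (x : 'I_n.+1) : block_cnt top_rel (enum 'I_n.+1) x = x.+1.
Proof.
rewrite /block_cnt -(count_map val (fun z => z <= x)) val_enum_ord -size_filter.
by rewrite (@filter_iota_ltn 0 n.+1 x.+1) ?size_iota.
Qed.

Lemma block_cnt_labels f (x : 'I_n.+1) :
  block_cnt top_rel (labels f) x = #|f @^-1: [set j : 'I_n | j < x.+1]|.
Proof.
rewrite /block_cnt /labels count_map cardE -size_filter /=; congr size.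
rewrite enumT; apply: eq_filter => i /=.
by rewrite !inE.
Qed.

Lemma nonmax_top (x : 'I_n.+1) : nonmax top_rel x = (x < n).
Proof.
apply/existsP/idP => [[y /= xy]|xn]; first by have := ltn_ord y; lia.
by exists ord_max.
Qed.

(** At x < n the block condition is the inequality of parking functions for k
    = x + 1, and at x = n it only counts the n labels. *)
Lemma block_parking_labels f :
  block_parking top_rel (labels f) <-> is_parking f.
Proof.
split=> [P|/forallP P x].
  apply/forallP => -[[//|k] kn].
  have := P (Ordinal (ltnW kn)).
  by rewrite nonmax_top block_cnt_enum block_cnt_labels /= -ltnS kn.
rewrite nonmax_top block_cnt_enum block_cnt_labels.
have [xn|xn] := ltnP x n; first exact: (P (Ordinal (xn : x.+1 < n.+1))).
have -> : f @^-1: [set j : 'I_n | j < x.+1] = setT.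
  by apply/setP => i; rewrite !inE; have := ltn_ord (f i); lia.
by rewrite cardsT card_ord; have := ltn_ord x; lia.
Qed.

(** A parking function is sent to the factorization whose smaller points, read
    from left to right, are its values. *)
Lemma parking_factorizations : exists F : parking n -> seq {perm 'I_n.+1},
  [/\ injective F, forall x, factorization (F x) &
      forall s, factorization s -> exists x, F x = s].
Proof.
have ex (x : parking n) : exists T : seq ('I_n.+1 * 'I_n.+1),
    [/\ unzip1 T = labels (val x), increasing T &
        mulseq (transpositions T) = long_cycle].
  apply: parking_factorization_exists top_equivalence long_cycle_succ _.
  by apply/block_parking_labels/valP.
have size_labels f : size (labels f) = n by rewrite size_map size_enum_ord.
pose T x := projT1 (cid (ex x)).
have TP x : [/\ unzip1 (T x) = labels (val x), increasing (T x) &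
    mulseq (transpositions (T x)) = long_cycle] := projT2 (cid (ex x)).
have sizeT x : size (T x) = n.
  by have [e _ _] := TP x; rewrite -[RHS](size_labels (val x)) -e size_map.
exists (fun x => transpositions (T x)); split.
- move=> x y e; apply/val_inj/labels_inj.
  have [<- ix _] := TP x; have [<- iy _] := TP y.
  by rewrite (transpositions_inj ix iy e).
- move=> x; have [_ ix px] := TP x.
  rewrite /factorization px eqxx size_map sizeT eqxx andbT.
  by apply/all_transpositionP; exists (T x).
- move=> s /and3P[/eqP ss /all_transpositionP[U iU eU] /eqP ps]; subst s.
  have sU : size U = n by rewrite -[RHS]ss size_map.
  have bound : #|porbits long_cycle| + size U <= n.+1.
    by rewrite sU; have := porbits_long_cycle; lia.
  have P :=
    minimal_factorization_parking top_equivalence long_cycle_succ iU ps bound.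
  have lt (i : 'I_n) : nth ord0 (unzip1 U) i < n.
    have iU' : i < size U by rewrite sU.
    rewrite (nth_map (ord0, ord0)) //.
    have /(all_nthP (ord0, ord0))/(_ i iU') /leq_trans := iU; apply.
    by rewrite -ltnS.
  pose f := [ffun i => Ordinal (lt i)].
  have ef : labels f = unzip1 U.
    apply: (@eq_from_nth _ ord0); rewrite size_labels ?size_map // => i lti.
    apply/val_inj; rewrite (nth_map (Ordinal lti)) ?size_enum_ord //= ffunE /=.
    by rewrite nth_enum_ord.
  have Pf : is_parking f by apply/block_parking_labels; rewrite ef.
  exists (exist _ f Pf).
  have [e iT pT] := TP (exist _ f Pf); congr transpositions.
  apply: (minimal_factorization_unique top_equivalence long_cycle_succ iT iU)
    => //.
    by rewrite sizeT -[X in _ + X]sU.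
  by rewrite e.
Qed.

End LongCycle.

(** * The action on parking functions *)

(** The Hurwitz action is carried over to parking functions along the
    bijection F with the factorizations of the long cycle. *)
Theorem theorem1p6 (n : nat) (hn : 1 <= n) :
  exists a : left_action (braid n) (parking n),
    forall (k : 'I_n.-1) (x : parking n),
      #|cyclic_orbit a (alpha k) x| = 2 \/ #|cyclic_orbit a (alpha k) x| = 3.
Proof.
have [F [Finj Ff Fsurj]] := parking_factorizations n.
have ex (k : 'I_n.-1) x : exists y, F y = hurwitz k (F x).
  exact/Fsurj/factorization_hurwitz.
have ex' (k : 'I_n.-1) x : exists y, F y = hurwitz_inv k (F x).
  exact/Fsurj/factorization_hurwitz_inv.
pose s k x := projT1 (cid (ex k x)).
have sE k x : F (s k x) = hurwitz k (F x) := projT2 (cid (ex k x)).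
pose s' k x := projT1 (cid (ex' k x)).
have s'E k x : F (s' k x) = hurwitz_inv k (F x) := projT2 (cid (ex' k x)).
have sizeF x : size (F x) = n by have /and3P[/eqP] := Ff x.
have ltk (k : 'I_n.-1) : k.+1 < n by have := ltn_ord k; lia.
have [a aE] : exists a : left_action (braid n) (parking n),
    forall k x, a (alpha k) x = s k x.
  apply: (@braid_action n _ s s').
  - by move=> k x; apply: Finj; rewrite s'E sE hurwitzK.
  - by move=> k x; apply: Finj; rewrite sE s'E hurwitz_invK.
  - by move=> k m x km; apply: Finj; rewrite !sE hurwitz_far.
  - move=> k m x mk; apply: Finj; rewrite !sE mk hurwitz_near // sizeF.
    by have := ltk m; rewrite mk.
exists a => k x; apply: cyclic_orbit_card23; rewrite !aE.
  move=> /(congr1 F); rewrite sE; exact: factorization_not_fixed (ltk k) (Ff x).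
have /and3P[_ tF _] := Ff x.
have := hurwitz_periodic k (@transposition_sq n.+1)
  (@transposition_braid n.+1) tF.
by case=> e; [left | right]; apply: Finj; rewrite !sE.
Qed.
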